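(* There exists a computable coloring $f : [\mathbb{N}]^{!\omega} \to \mathbb{N}$ such that every infinite $f$-thin set $H$ computes $\emptyset^{(\omega)}$. Moreover, this computation is uniform in $H$ and an avoided color: there is a Turing functional $\Phi$ such that for every infinite $H \subseteq \mathbb{N}$ and every $c \in \mathbb{N}$ with $c \notin f([H]^{!\omega})$, $\Phi^{H}(c) = \emptyset^{(\omega)}$.
   Context: For $X \subseteq \mathbb{N}$, $[X]^{!\omega}$ denotes the set of all finite $s \subseteq X$ that are exactly $\omega$-large, i.e. $|s| = 1 + \min s$. A set $H \subseteq \mathbb{N}$ is $f$-thin (for $f : [\mathbb{N}]^{!\omega} \to \mathbb{N}$) if $f([H]^{!\omega}) \neq \mathbb{N}$; a color $c \notin f([H]^{!\omega})$ is called an avoided color. $\emptyset^{(\omega)} = \bigoplus_n \emptyset^{(n)}$ is the $\omega$-th Turing jump of the empty set. *)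

(* Defs.v *)
From HB Require Import structures.
From mathcomp Require Import all_boot finmap zify.
From mathcomp Require Export boolp classical_sets functions cardinality.
From Stdlib Require Cantor.

Set Implicit Arguments.
Unset Strict Implicit.
Unset Printing Implicit Defensive.

Local Open Scope nat_scope.
Local Open Scope classical_set_scope.

Definition npair (x y : nat) : nat := Cantor.to_nat (x, y).
Definition nfst (z : nat) : nat := (Cantor.of_nat z).1.
Definition nsnd (z : nat) : nat := (Cantor.of_nat z).2.

Lemma nfst_npair x y : nfst (npair x y) = x.
Proof. by rewrite /nfst /npair Cantor.cancel_of_to. Qed.

Lemma nsnd_npair x y : nsnd (npair x y) = y.
Proof. by rewrite /nsnd /npair Cantor.cancel_of_to. Qed.

Lemma npairK z : npair (nfst z) (nsnd z) = z.
Proof.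
by rewrite /nfst /nsnd /npair -surjective_pairing Cantor.cancel_to_of.
Qed.

(* Programs for the partial recursive functions relative to an oracle.  All
   functions are unary; several arguments are passed through [npair], so the
   identity is [Pair Left Right]. *)
Inductive program : Type :=
| Zero | Succ | Left | Right | Oracle
| Pair of program & program
| Comp of program & program
| Prec of program & program
| Mini of program.

(* Partial functions nat -> nat are represented by their graphs. *)
Definition pfun := nat -> nat -> Prop.

(* h <a, 0> = F a and h <a, n + 1> = G <a, <n, h <a, n>>> *)
Fixpoint prec_graph (F G : pfun) (a n y : nat) : Prop :=
  if n is m.+1
  then exists2 u, prec_graph F G a m u & G (npair a (npair m u)) y
  else F a y.

(* The least y with F <a, y> = 0; as usual F <a, m> must be defined for all
   m < y. *)
Definition mini_graph (F : pfun) (a y : nat) : Prop :=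
  F (npair a y) 0 /\ forall m, m < y -> exists u, F (npair a m) u.+1.

(* [eval A p x y]: program p with oracle A halts on input x with output y. *)
Fixpoint eval (A : set nat) (p : program) (x y : nat) {struct p} : Prop :=
  match p with
  | Zero => y = 0
  | Succ => y = x.+1
  | Left => y = nfst x
  | Right => y = nsnd x
  | Oracle => y = nat_of_bool (x \in A)
  | Pair p q => exists u v, [/\ eval A p x u, eval A q x v & y = npair u v]
  | Comp p q => exists2 u, eval A q x u & eval A p u y
  | Prec p q => prec_graph (eval A p) (eval A q) (nfst x) (nsnd x) y
  | Mini p => mini_graph (eval A p) x y
  end.

Lemma eval_functional A p x y z : eval A p x y -> eval A p x z -> y = z.
Proof.
elim: p x y z => [||||| p IHp q IHq | p IHp q IHq | p IHp q IHq | p IHp] x y z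
  /=; try by move=> -> ->.
- move=> [u [v [pu qv ->]]] [u' [v' [pu' qv' ->]]].
  by rewrite (IHp _ _ _ pu pu') (IHq _ _ _ qv qv').
- by move=> [u qu pu] [v qv]; rewrite -(IHq _ _ _ qu qv) => /(IHp _ _ _ pu).
- elim: (nsnd x) y z => [|n IHn] y z /=; first exact: IHp.
  by move=> [u ru qu] [v rv]; rewrite -(IHn _ _ ru rv) => /(IHq _ _ _ qu).
- move=> [py0 py] [pz0 pz]; case: (ltngtP y z) => // [/pz | /py] [u pu].
  + by have := IHp _ _ _ py0 pu.
  + by have := IHp _ _ _ pz0 pu.
Qed.

(* Injective, and with decidable range, so that the jump below is the diagonal
   halting problem for an effective numbering. *)
Fixpoint goedel_number (p : program) : nat :=
  match p with
  | Zero => 0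
  | Succ => 1
  | Left => 2
  | Right => 3
  | Oracle => 4
  | Pair p q => 4 * npair (goedel_number p) (goedel_number q) + 5
  | Comp p q => 4 * npair (goedel_number p) (goedel_number q) + 6
  | Prec p q => 4 * npair (goedel_number p) (goedel_number q) + 7
  | Mini p => 4 * goedel_number p + 8
  end.

Lemma goedel_number_inj : injective goedel_number.
Proof.
have npair_inj x y x' y' : npair x y = npair x' y' -> x = x' /\ y = y'.
  by move=> e; rewrite -(nfst_npair x y) -{2}(nsnd_npair x y) e nfst_npair
    nsnd_npair.
elim=> [||||| p IHp q IHq | p IHp q IHq | p IHp q IHq | p IHp]
  [||||| p' q' | p' q' | p' q' | p'] //= e; try by exfalso; lia.
- by have /npair_inj[/IHp -> /IHq ->] :
    npair (goedel_number p) (goedel_number q) =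
    npair (goedel_number p') (goedel_number q') by lia.
- by have /npair_inj[/IHp -> /IHq ->] :
    npair (goedel_number p) (goedel_number q) =
    npair (goedel_number p') (goedel_number q') by lia.
- by have /npair_inj[/IHp -> /IHq ->] :
    npair (goedel_number p) (goedel_number q) =
    npair (goedel_number p') (goedel_number q') by lia.
- by have /IHp -> : goedel_number p = goedel_number p' by lia.
Qed.

Definition computes (A : set nat) (p : program) (g : nat -> nat) : Prop :=
  forall x, eval A p x (g x).

Definition char_fun (B : set nat) (x : nat) : nat := nat_of_bool (x \in B).

Definition turing_le (B A : set nat) : Prop :=
  exists p, computes A p (char_fun B).

Definition jump (A : set nat) : set nat :=
  [set e | exists p y, goedel_number p = e /\ eval A p e y].

Definition iter_jump (n : nat) : set nat := iter n jump set0.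

Definition omega_jump : set nat :=
  [set z | exists n x, z = npair n x /\ iter_jump n x].

(* Equal to 0 on the empty set, which is therefore not exactly omega-large. *)
Definition fset_min (s : {fset nat}) : nat := head 0 (sort leq s).

Definition exactly_large (s : {fset nat}) : bool := #|` s| == 1 + fset_min s.

Definition large_set : Type := {s : {fset nat} | exactly_large s}.

Definition large_subsets (X : set nat) : set large_set :=
  [set s | [set x | x \in val s] `<=` X].

(* The set s is input to programs through its canonical (strong) index, the
   number whose binary digits are the characteristic function of s. *)
Definition canonical_index (s : {fset nat}) : nat := \sum_(x <- s) 2 ^ x.

Definition computable_coloring (f : large_set -> nat) : Prop :=
  exists p, forall s : large_set,
    eval set0 p (canonical_index (val s)) (f s).

Definition avoided (f : large_set -> nat) (H : set nat) (c : nat) : Prop :=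
  ~ (f @` large_subsets H) c.

Definition thin (f : large_set -> nat) (H : set nat) : Prop :=
  f @` large_subsets H <> [set: nat].

(* Phi^A(c) = B: as a function of x, Phi^A(c, x) is the characteristic function
   of B. *)
Definition functional_value (Phi : program) (A : set nat) (c : nat)
    (B : set nat) : Prop :=
  forall x, eval A Phi (npair c x) (char_fun B x).

(* Main.v *)
(** Write the elements of an exactly omega-large set as [a_0 < ... < a_m], where
    [m = a_0], and put [h = m / 2].  Iterating bounded approximations of the
    jump with the bounds [a_m, ..., a_(h+1)] (outermost bound [a_(h+1)]) yields a
    finite approximation [o] of the omega-jump.  A gap [(x, y)] is large when
    every [u < x] lying in one of the first [h] columns of [o] is already seen
    to be there by computations bounded by [y].  The color is the number of
    [i < h] such that [(a_i, a_(i+1))] is large.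

    If [H] avoids the color [c] and [m] in [H] satisfies [c < h], then the gap
    between [m] and its [(h - c)]-th successor in [H] is large for the true
    omega-jump: otherwise taking these successors, whose consecutive gaps are
    then all small, followed by very sparse elements of [H], for which the gaps
    are large and the approximation [o] is correct, realizes the color [c].  So
    [H] and [c] compute arbitrarily long sequences with large gaps, and the
    approximation along such a sequence is correct below its first element. *)

From mathcomp Require Import all_boot finmap zify.
Require Import Defs.
Set Implicit Arguments.
Unset Strict Implicit.
Unset Printing Implicit Defensive.
Local Open Scope nat_scope.
Local Open Scope classical_set_scope.

(** * Functions computable by one program for all oracles of a class *)

Section Recursive.
Variable D : set nat -> Prop.

(** Oracles outside [D] put no constraint on [F]. This lets the decoder search its oracle without
    bound, since it is only run on infinite sets. *)
Definition recursive_on (F : set nat -> nat -> nat) : Prop :=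
  exists p, forall A, D A -> computes A p (F A).

Definition recursive_on2 (F : set nat -> nat -> nat -> nat) : Prop :=
  recursive_on (fun A z => F A (nfst z) (nsnd z)).

Implicit Types F G : set nat -> nat -> nat.

Lemma rec_ext F G : (forall A x, D A -> F A x = G A x) ->
  recursive_on F -> recursive_on G.
Proof. by move=> FG [p pF]; exists p => A DA x; rewrite -FG //; apply: pF. Qed.

Lemma rec_id : recursive_on (fun _ x => x).
Proof.
exists (Pair Left Right) => A _ x /=; exists (nfst x), (nsnd x).
by rewrite npairK.
Qed.

Lemma rec_npair F G : recursive_on F -> recursive_on G ->
  recursive_on (fun A x => npair (F A x) (G A x)).
Proof.
move=> [p pF] [q qG]; exists (Pair p q) => A DA x /=.
by exists (F A x), (G A x); split=> //; [exact: pF | exact: qG].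
Qed.

Lemma rec_comp G F : recursive_on G -> recursive_on F ->
  recursive_on (fun A x => G A (F A x)).
Proof.
move=> [p pG] [q qF]; exists (Comp p q) => A DA x /=.
by exists (F A x); [exact: qF | exact: pG].
Qed.

Lemma rec_fst F : recursive_on F -> recursive_on (fun A x => nfst (F A x)).
Proof. by apply: (@rec_comp (fun _ => nfst)); exists Left. Qed.

Lemma rec_snd F : recursive_on F -> recursive_on (fun A x => nsnd (F A x)).
Proof. by apply: (@rec_comp (fun _ => nsnd)); exists Right. Qed.

Lemma rec_succ F : recursive_on F -> recursive_on (fun A x => (F A x).+1).
Proof. by apply: (@rec_comp (fun _ => succn)); exists Succ. Qed.

Lemma rec_const n : recursive_on (fun _ _ => n).
Proof. by elim: n => [|n IH]; [exists Zero | apply: rec_succ]. Qed.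

Lemma rec_oracle F : recursive_on F ->
  recursive_on (fun A x => nat_of_bool (F A x \in A)).
Proof. by apply: (@rec_comp (fun A x => nat_of_bool (x \in A))); exists Oracle. Qed.

Lemma rec_comp2 (G : set nat -> nat -> nat -> nat) F1 F2 :
  recursive_on2 G -> recursive_on F1 -> recursive_on F2 ->
  recursive_on (fun A x => G A (F1 A x) (F2 A x)).
Proof.
move=> rG rF1 rF2; have := rec_comp rG (rec_npair rF1 rF2).
by apply: rec_ext => A x _; rewrite nfst_npair nsnd_npair.
Qed.

Lemma rec_prec (B : set nat -> nat -> nat)
    (S : set nat -> nat -> nat -> nat -> nat) N :
  recursive_on B ->
  recursive_on (fun A z => S A (nfst z) (nfst (nsnd z)) (nsnd (nsnd z))) ->
  recursive_on N ->
  recursive_on (fun A x => iteri (N A x) (S A x) (B A x)).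
Proof.
move=> [p pB] [q qS] rN.
suff : recursive_on2 (fun A x n => iteri n (S A x) (B A x)).
  by move/rec_comp2; apply=> //; exact: rec_id.
exists (Prec p q) => A DA z /=.
elim: (nsnd z) => [|n IH] /=; first exact: pB.
exists (iteri n (S A (nfst z)) (B A (nfst z))) => //.
by have := qS A DA (npair (nfst z)
  (npair n (iteri n (S A (nfst z)) (B A (nfst z))))); rewrite !(nfst_npair, nsnd_npair).
Qed.

Implicit Types P Q : set nat -> nat -> bool.

Lemma rec_pred F : recursive_on F -> recursive_on (fun A x => (F A x).-1).
Proof.
apply: (@rec_comp (fun _ => predn)).
(* The step returns the counter and forgets the previous value, so [x] rounds end in [x.-1]. *)
have := @rec_prec (fun _ _ => 0) (fun _ _ i _ => i) (fun _ x => x).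
move=> /(_ (rec_const 0) (rec_fst (rec_snd rec_id)) rec_id).
by apply: rec_ext => A [].
Qed.

Lemma rec_add F G : recursive_on F -> recursive_on G ->
  recursive_on (fun A x => F A x + G A x).
Proof.
move=> rF rG.
have := rec_prec rF (S := fun _ _ _ r => r.+1) (rec_succ (rec_snd (rec_snd rec_id))) rG.
by apply: rec_ext => A x _; elim: (G A x) => [|n /= ->] /=; lia.
Qed.

Lemma rec_sub F G : recursive_on F -> recursive_on G ->
  recursive_on (fun A x => F A x - G A x).
Proof.
move=> rF rG.
have := rec_prec rF (S := fun _ _ _ r => r.-1) (rec_pred (rec_snd (rec_snd rec_id))) rG.
by apply: rec_ext => A x _; elim: (G A x) => [|n /= ->] /=; lia.
Qed.

Lemma rec_sum (F2 : set nat -> nat -> nat -> nat) N :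
  recursive_on2 F2 -> recursive_on N ->
  recursive_on (fun A x => \sum_(0 <= i < N A x) F2 A x i).
Proof.
move=> rF rN.
have := @rec_prec (fun _ _ => 0) (fun A x i r => r + F2 A x i) _ (rec_const 0) _ rN.
have r2 := rec_snd rec_id.
move=> /(_ (rec_add (rec_snd r2) (rec_comp2 rF (rec_fst rec_id) (rec_fst r2)))).
apply: rec_ext => A x _; elim: (N A x) => [|n /= ->]; first by rewrite big_nil.
by rewrite big_nat_recr.
Qed.

Lemma rec_mul F G : recursive_on F -> recursive_on G ->
  recursive_on (fun A x => F A x * G A x).
Proof.
move=> rF rG.
have rF2 : recursive_on2 (fun A x _ => F A x) by exact: rec_comp (rec_fst rec_id).
have := rec_sum rF2 rG.
by apply: rec_ext => A x _; rewrite sum_nat_const_nat subn0 mulnC.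
Qed.

Lemma rec_exp F G : recursive_on F -> recursive_on G ->
  recursive_on (fun A x => F A x ^ G A x).
Proof.
move=> rF rG.
have := @rec_prec (fun _ _ => 1) (fun A x _ r => F A x * r) _ (rec_const 1)
  (rec_mul (rec_comp rF (rec_fst rec_id)) (rec_snd (rec_snd rec_id))) rG.
by apply: rec_ext => A x _; elim: (G A x) => [|n /= ->]; rewrite ?expnS.
Qed.

Lemma rec_if P F G : recursive_on (fun A x => P A x : nat) ->
  recursive_on F -> recursive_on G ->
  recursive_on (fun A x => if P A x then F A x else G A x).
Proof.
move=> rP rF rG.
(* The truth value of [P] is the number of rounds: none keeps [G], one replaces it by [F]. *)
have := rec_prec rG (S := fun A x _ _ => F A x) (rec_comp rF (rec_fst rec_id)) rP.
by apply: rec_ext => A x _; case: (P A x).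
Qed.

Lemma rec_leq F G : recursive_on F -> recursive_on G ->
  recursive_on (fun A x => F A x <= G A x : nat).
Proof.
move=> rF rG; have := rec_sub (rec_const 1) (rec_sub rF rG).
by apply: rec_ext => A x _; case: leqP => ?; lia.
Qed.

Lemma rec_andb P Q : recursive_on (fun A x => P A x : nat) ->
  recursive_on (fun A x => Q A x : nat) ->
  recursive_on (fun A x => P A x && Q A x : nat).
Proof.
move=> rP rQ; have := rec_mul rP rQ.
by apply: rec_ext => A x _; rewrite mulnb.
Qed.

Lemma rec_negb P : recursive_on (fun A x => P A x : nat) ->
  recursive_on (fun A x => ~~ P A x : nat).
Proof.
move=> rP; have := rec_sub (rec_const 1) rP.
by apply: rec_ext => A x _; case: (P A x).
Qed.

Lemma rec_implb P Q : recursive_on (fun A x => P A x : nat) ->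
  recursive_on (fun A x => Q A x : nat) ->
  recursive_on (fun A x => P A x ==> Q A x : nat).
Proof.
move=> rP rQ; have := rec_negb (rec_andb rP (rec_negb rQ)).
by apply: rec_ext => A x _; case: (P A x); case: (Q A x).
Qed.

Lemma rec_eqn F G : recursive_on F -> recursive_on G ->
  recursive_on (fun A x => F A x == G A x : nat).
Proof.
move=> rF rG; have := rec_andb (rec_leq rF rG) (rec_leq rG rF).
by apply: rec_ext => A x _; rewrite eqn_leq.
Qed.

Lemma rec_all (P2 : set nat -> nat -> nat -> bool) N :
  recursive_on2 (fun A x i => P2 A x i : nat) -> recursive_on N ->
  recursive_on (fun A x => all (P2 A x) (iota 0 (N A x)) : nat).
Proof.
move=> rP rN.
have rNP : recursive_on2 (fun A x i => ~~ P2 A x i : nat) by exact: rec_negb.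
have := rec_eqn (rec_sum rNP rN) (rec_const 0).
apply: rec_ext => A x _; congr nat_of_bool; rewrite /index_iota subn0.
elim: (iota _ _) => [|i s IH]; rewrite ?big_nil // big_cons addn_eq0 IH /=.
by case: (P2 A x i).
Qed.

Lemma rec_has (P2 : set nat -> nat -> nat -> bool) N :
  recursive_on2 (fun A x i => P2 A x i : nat) -> recursive_on N ->
  recursive_on (fun A x => has (P2 A x) (iota 0 (N A x)) : nat).
Proof.
move=> rP rN.
have := rec_negb (rec_all (P2 := fun A x i => ~~ P2 A x i) (rec_negb rP) rN).
apply: rec_ext => A x _; rewrite -has_predC; congr nat_of_bool.
by apply: eq_has => i /=; rewrite negbK.
Qed.

Lemma rec_div F G : recursive_on F -> recursive_on G ->
  recursive_on (fun A x => F A x %/ G A x).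
Proof.
move=> rF rG.
have r1 := rec_fst rec_id.
(* The quotient counts the positive multiples of the divisor up to [F A x]; the guard yields [0] for
   divisor [0], in agreement with [divn]. *)
have := rec_sum (F2 := fun A x i => (0 < G A x) && (i.+1 * G A x <= F A x) : nat) _ rF.
move=> /(_ (rec_andb (rec_leq (rec_const 1) (rec_comp rG r1))
  (rec_leq (rec_mul (rec_succ (rec_snd rec_id)) (rec_comp rG r1)) (rec_comp rF r1)))).
apply: rec_ext => A x _; set m := F A x; set d := G A x.
case: (posnP d) => [->|d0]; first by rewrite big1.
under eq_bigr do rewrite -leq_divRL //=.
have: m %/ d <= m by apply: leq_div.
move: (m %/ d) => k km; rewrite (big_cat_nat (n := k)) //=.
rewrite (eq_big_nat _ _ (F2 := fun=> 1)) => [|i /andP[_ ->] //].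
rewrite sum_nat_const_nat big_nat big1 ?muln1 ?subn0 ?addn0 // => i /andP[ki _].
by rewrite ltnNge ki.
Qed.

Lemma rec_mod F G : recursive_on F -> recursive_on G ->
  recursive_on (fun A x => F A x %% G A x).
Proof.
move=> rF rG; have := rec_sub rF (rec_mul (rec_div rF rG) rG).
by apply: rec_ext => A x _; rewrite {1}(divn_eq (F A x) (G A x)); lia.
Qed.

Lemma rec_mini (P2 : set nat -> nat -> nat -> bool) F :
  recursive_on2 (fun A x i => P2 A x i : nat) ->
  (forall A x, D A -> P2 A x (F A x)) ->
  (forall A x i, D A -> P2 A x i -> F A x <= i) ->
  recursive_on F.
Proof.
move=> /rec_negb[p pP] FP minF; exists (Mini p) => A DA x /=; split.
  by have := pP A DA (npair x (F A x)); rewrite nfst_npair nsnd_npair FP.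
move=> i iF; exists 0; have := pP A DA (npair x i); rewrite nfst_npair nsnd_npair.
by case: (boolP (P2 A x i)) => // /(minF _ _ _ DA); rewrite leqNgt iF.
Qed.

End Recursive.

(* Splits a goal [recursive_on D (fun A x => e)] along the head symbol of [e];
   [rec_user] is the hook for symbols defined later. *)
Ltac rec_user := fail.
Ltac rec_variable :=
  lazymatch goal with
  | |- recursive_on ?D (fun A x => ?F A (@?G A x) (@?H A x)) =>
      is_var F; apply: (@rec_comp2 D F G H)
  | |- recursive_on ?D (fun A x => ?F A (@?G A x)) =>
      is_var F; apply: (@rec_comp D F G)
  end.
Ltac rec_step :=
  cbv beta;
  lazymatch goal with
  | |- recursive_on2 _ _ => rewrite /recursive_on2
  | |- recursive_on ?D (fun A x => x) => exact: rec_id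
  | |- recursive_on ?D (fun A x => nfst (@?F A x)) => apply: (@rec_fst D F)
  | |- recursive_on ?D (fun A x => nsnd (@?F A x)) => apply: (@rec_snd D F)
  | |- recursive_on ?D (fun A x => npair (@?F A x) (@?G A x)) =>
      apply: (@rec_npair D F G)
  | |- recursive_on ?D (fun A x => succn (@?F A x)) => apply: (@rec_succ D F)
  | |- recursive_on ?D (fun A x => predn (@?F A x)) => apply: (@rec_pred D F)
  | |- recursive_on ?D (fun A x => addn (@?F A x) (@?G A x)) =>
      apply: (@rec_add D F G)
  | |- recursive_on ?D (fun A x => subn (@?F A x) (@?G A x)) =>
      apply: (@rec_sub D F G)
  | |- recursive_on ?D (fun A x => muln (@?F A x) (@?G A x)) =>
      apply: (@rec_mul D F G)
  | |- recursive_on ?D (fun A x => expn (@?F A x) (@?G A x)) =>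
      apply: (@rec_exp D F G)
  | |- recursive_on ?D (fun A x => divn (@?F A x) (@?G A x)) =>
      apply: (@rec_div D F G)
  | |- recursive_on ?D (fun A x => modn (@?F A x) (@?G A x)) =>
      apply: (@rec_mod D F G)
  | |- recursive_on ?D (fun A x => nat_of_bool (leq (@?F A x) (@?G A x))) =>
      apply: (@rec_leq D F G)
  | |- recursive_on ?D (fun A x => nat_of_bool (eq_op (@?F A x) (@?G A x))) =>
      apply: (@rec_eqn D F G)
  | |- recursive_on ?D (fun A x => nat_of_bool (andb (@?F A x) (@?G A x))) =>
      apply: (@rec_andb D F G)
  | |- recursive_on ?D (fun A x => nat_of_bool (implb (@?F A x) (@?G A x))) =>
      apply: (@rec_implb D F G)
  | |- recursive_on ?D (fun A x => nat_of_bool (negb (@?F A x))) =>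
      apply: (@rec_negb D F)
  | |- recursive_on ?D (fun A x => nat_of_bool (all (@?P A x) (iota 0 (@?N A x)))) =>
      apply: (@rec_all D P N)
  | |- recursive_on ?D (fun A x => nat_of_bool (has (@?P A x) (iota 0 (@?N A x)))) =>
      apply: (@rec_has D P N)
  | |- recursive_on ?D (fun A x => nat_of_bool (@?F A x \in A)) =>
      apply: (@rec_oracle D F)
  | |- recursive_on ?D (fun A x => bigop _ (index_iota 0 (@?N A x))
        (fun i => BigBody i _ true (@?F A x i))) => apply: (@rec_sum D F N)
  | |- recursive_on ?D (fun A x => iteri (@?N A x) (@?S A x) (@?B A x)) =>
      apply: (@rec_prec D B S N)
  | |- recursive_on ?D (fun A x => if _ then _ else _) => apply: rec_if
  | _ => first [exact: rec_const | rec_user | rec_variable]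
  end.
Ltac rec := repeat first [assumption | rec_step].

(** * Finite sets coded by binary digits *)

Definition bit (t k : nat) : bool := (t %/ 2 ^ k) %% 2 == 1.

Lemma rec_bit D F G : recursive_on D F -> recursive_on D G ->
  recursive_on D (fun A x => bit (F A x) (G A x) : nat).
Proof. by move=> rF rG; rewrite /bit; rec. Qed.

(** Position [n] is still free in [t], so the addition writes the digit [s] there without a carry.
    Numbers can thus be filled digit by digit. *)
Lemma bit_add t k n (s : bool) : t < 2 ^ n ->
  bit (t + 2 ^ n * s) k = if k < n then bit t k else (k == n) && s.
Proof.
move=> tn; have k0 : 0 < 2 ^ k by rewrite expn_gt0.
rewrite /bit; case: ltngtP => [kn | nk | ->].
(* An even multiple of [2 ^ k] does not affect digit [k]. *)
- have -> : 2 ^ n * s = 2 ^ (n - k.+1) * s * 2 * 2 ^ k.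
    have {1}-> : n = (n - k.+1) + k.+1 by lia.
    by rewrite expnD expnS; nia.
  by rewrite addnC divnMDl // -modnDml modnMl.
- rewrite divn_small // (@leq_trans (2 ^ n.+1)) ?leq_exp2l //.
  by rewrite expnS; case: s; lia.
- rewrite mulnC divnDMl ?expn_gt0 // divn_small //.
  by case: s.
Qed.

Lemma bit_sum (P : nat -> bool) n k :
  bit (\sum_(0 <= i < n) 2 ^ i * P i) k = (k < n) && P k.
Proof.
have lt m : \sum_(0 <= i < m) 2 ^ i * P i < 2 ^ m.
  elim: m => [|m IH]; first by rewrite big_nil.
  by rewrite big_nat_recr //= expnS; case: (P m); lia.
elim: n => [|n IH]; first by rewrite big_nil /bit div0n.
by rewrite big_nat_recr //= bit_add // IH ltnS; case: ltngtP => [||->].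
Qed.

Lemma bit_canonical_index (s : {fset nat}) x :
  bit (canonical_index s) x = (x \in s).
Proof.
rewrite /canonical_index; have [n sn] : exists n, forall x, x \in s -> x < n.
  exists (\max_(x <- s) x).+1 => y ys; rewrite ltnS.
  by rewrite (big_fsetD1 y) //= leq_maxl.
have -> : \sum_(x <- s) 2 ^ x = \sum_(0 <= i < n) 2 ^ i * (i \in s).
  rewrite /index_iota subn0 [RHS](bigID (fun i => i \in s)) /= [X in _ + X]big1; last first.
    by move=> i /negbTE ->; rewrite muln0.
  rewrite addn0 -[RHS]big_filter; under [RHS]eq_big_seq => i.
    by rewrite mem_filter => /andP[-> _]; rewrite muln1; over.
  apply: perm_big; apply: uniq_perm; rewrite ?filter_uniq ?iota_uniq ?fset_uniq //.
  move=> y; rewrite mem_filter mem_iota add0n /=.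
  by case: (boolP (y \in s)) => // /sn ->.
by rewrite bit_sum; case: (boolP (x \in s)) => [/sn -> | _] //; rewrite andbF.
Qed.

(** * Evaluation of programs with bounded values *)

Fixpoint bounded_prec (F G : rel nat) (b a m v : nat) : bool :=
  if m is m'.+1
  then has (fun u => bounded_prec F G b a m' u && G (npair a (npair m' u)) v)
    (iota 0 b)
  else F a v.

(* [eval] with all intermediate values below [b], relative to the [n]-th column
   of [o], which is only consulted below [b]. *)
Fixpoint bounded_eval (o : pred nat) (n b : nat) (p : program) (x v : nat) :
    bool :=
  [&& x < b, v < b &
  match p with
  | Zero => v == 0
  | Succ => v == x.+1
  | Left => v == nfst x
  | Right => v == nsnd x
  | Oracle => (npair n x < b) && (v == o (npair n x))
  | Pair p q => bounded_eval o n b p x (nfst v) && bounded_eval o n b q x (nsnd v)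
  | Comp p q =>
      has (fun u => bounded_eval o n b q x u && bounded_eval o n b p u v) (iota 0 b)
  | Prec p q => bounded_prec (bounded_eval o n b p) (bounded_eval o n b q) b
      (nfst x) (nsnd x) v
  | Mini p => bounded_eval o n b p (npair x v) 0 &&
      all (fun m => has (fun u => bounded_eval o n b p (npair x m) u.+1) (iota 0 b))
        (iota 0 v)
  end].

Lemma has_iotaP (P : pred nat) n :
  reflect (exists2 i, i < n & P i) (has P (iota 0 n)).
Proof. by apply: (iffP hasP) => -[i]; rewrite ?mem_iota => ? ?; exists i; rewrite ?mem_iota. Qed.

Lemma all_iotaP (P : pred nat) n :
  reflect (forall i, i < n -> P i) (all P (iota 0 n)).
Proof. by apply: (iffP allP) => h i; have := h i; rewrite mem_iota. Qed.

Lemma npair_ge x y : (x <= npair x y) && (y <= npair x y).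
Proof. by rewrite /npair; have := Cantor.to_nat_non_decreasing x y; lia. Qed.

Lemma nfst_le x : nfst x <= x.
Proof. by rewrite -{2}(npairK x); have /andP[] := npair_ge (nfst x) (nsnd x). Qed.

Lemma nsnd_le x : nsnd x <= x.
Proof. by rewrite -{2}(npairK x); have /andP[] := npair_ge (nfst x) (nsnd x). Qed.

(** Ensures that the recursive call of a [Prec] program has a smaller argument. *)
Lemma npair_ltr x y z : y < z -> npair x y < npair x z.
Proof.
rewrite /npair => yz.
have e a c : (Cantor.to_nat (a, c)).*2 = (a + c) * (a + c).+1 + c.*2.
  have := Cantor.to_nat_spec a c; lia.
by have := e x y; have := e x z; nia.
Qed.

Lemma bounded_eval_sound o n b p x v : bounded_eval o n b p x v ->
  eval [set z | o (npair n z)] p x v.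
Proof.
elim: p x v => [||||| p IHp q IHq | p IHp q IHq | p IHp q IHq | p IHp] x v
  /= /and3P[_ _].
- by move/eqP.
- by move/eqP.
- by move/eqP.
- by move/eqP.
- case/andP=> _ /eqP ->; congr nat_of_bool; apply/idP/idP => h; first by rewrite inE.
  by rewrite inE in h.
- by case/andP=> /IHp hp /IHq hq; exists (nfst v), (nsnd v); rewrite npairK.
- by case/has_iotaP => u _ /andP[/IHq hq /IHp hp]; exists u.
- elim: (nsnd x) v => [|m IH] v /=; first exact: IHp.
  by case/has_iotaP => u _ /andP[/IH hu /IHq hq]; exists u.
- case/andP => /IHp h0 /all_iotaP h; split=> // m /h /has_iotaP[u _ /IHp].
  by exists u.
Qed.

Lemma bounded_eval_lt o n b p x v : bounded_eval o n b p x v -> (x < b) && (v < b).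
Proof. by case: p => /=[||||| ? ? | ? ? | ? ? | ?] /and3P[-> ->]. Qed.

Lemma bounded_eval_mono o n b b' p x v : b <= b' ->
  bounded_eval o n b p x v -> bounded_eval o n b' p x v.
Proof.
move=> bb.
elim: p x v => [||||| p IHp q IHq | p IHp q IHq | p IHp q IHq | p IHp] x v
  /= /and3P[xb vb h]; rewrite (leq_trans xb bb) (leq_trans vb bb) //=.
- by case/andP: h => /leq_trans -> // ->.
- by case/andP: h => /IHp -> /IHq ->.
- case/has_iotaP: h => u ub /andP[hq hp]; apply/has_iotaP.
  by exists u; [exact: leq_trans bb | rewrite IHq ?IHp].
- elim: (nsnd x) v {vb} h => [|m IH] v /=; first exact: IHp.
  case/has_iotaP => u ub /andP[hu hq]; apply/has_iotaP.
  by exists u; [exact: leq_trans bb | rewrite IH ?IHq].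
- case/andP: h => /IHp -> /all_iotaP h; apply/all_iotaP => m /h /has_iotaP[u ub hu].
  by apply/has_iotaP; exists u; [exact: leq_trans bb | rewrite IHp].
Qed.

Lemma bounded_prec_mono o n b b' p q a m v : b <= b' ->
  bounded_prec (bounded_eval o n b p) (bounded_eval o n b q) b a m v ->
  bounded_prec (bounded_eval o n b' p) (bounded_eval o n b' q) b' a m v.
Proof.
move=> bb; elim: m v => [|m IH] v /=; first exact: bounded_eval_mono.
case/has_iotaP => u ub /andP[hu hq]; apply/has_iotaP.
exists u; first exact: leq_trans bb.
by rewrite IH ?(bounded_eval_mono bb hq).
Qed.

Lemma collect_bound (Q : nat -> nat -> Prop) n :
  (forall m b b', b <= b' -> Q m b -> Q m b') ->
  (forall m, m < n -> exists b, Q m b) -> exists b, forall m, m < n -> Q m b.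
Proof.
move=> monoQ; elim: n => [|n IH] h; first by exists 0.
have [|b hb] := IH; first by move=> m mn; apply: h; exact: ltnW.
have [b' hb'] := h n (ltnSn n); exists (maxn b b') => m; rewrite ltnS leq_eqVlt.
case/predU1P => [-> | /hb]; [move: hb' | ]; apply: monoQ; lia.
Qed.

(** A halting computation meets finitely many values and oracle questions; the bounds of its parts
    are merged by [maxn] and monotonicity. *)
Lemma bounded_eval_complete (o : pred nat) n p x v : eval [set z | o (npair n z)] p x v ->
  exists b, bounded_eval o n b p x v.
Proof.
elim: p x v => [||||| p IHp q IHq | p IHp q IHq | p IHp q IHq | p IHp] x v /=.
- by move=> ->; exists x.+1; rewrite ltnSn eqxx.
- by move=> ->; exists x.+2; rewrite !ltnS leqnSn leqnn eqxx.
- by move=> ->; exists x.+1; rewrite !ltnS leqnn nfst_le eqxx.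
- by move=> ->; exists x.+1; rewrite !ltnS leqnn nsnd_le eqxx.
(* The bound exceeds the question [npair n x], hence also [x], and the answer, which may be [1]. *)
- move=> ->; exists (npair n x).+2; have /andP[_ xn] := npair_ge n x.
  have -> : (x \in [set z | o (npair n z)]) = o (npair n x).
    by apply/idP/idP => [/set_mem | /mem_set].
  by rewrite ltnS (leq_trans xn) //= eqxx leqnSn andbT; case: (o _).
- move=> [u [w [/IHp[b hb] /IHq[b' hb'] ->]]].
  exists (maxn (maxn b b') (npair u w).+1); rewrite nfst_npair nsnd_npair.
  rewrite (bounded_eval_mono _ hb) ?(bounded_eval_mono _ hb') ?leq_max ?leqnn ?orbT //.
  by have /andP[xb _] := bounded_eval_lt hb; rewrite ?leq_max xb.
- move=> [u /IHq[b hb] /IHp[b' hb']]; exists (maxn b b').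
  have /andP[xb ub] := bounded_eval_lt hb; have /andP[_ vb] := bounded_eval_lt hb'.
  rewrite ?leq_max xb vb orbT /=; apply/has_iotaP; exists u; rewrite ?leq_max ?ub //.
  by rewrite (bounded_eval_mono _ hb) ?(bounded_eval_mono _ hb') ?leq_max ?leqnn ?orbT.
- move=> h; suff [b hb] : exists b, bounded_prec (bounded_eval o n b p)
      (bounded_eval o n b q) b (nfst x) (nsnd x) v.
    exists (maxn b (maxn x v).+1); rewrite !leq_max !ltnS !leq_max !leqnn !orbT /=.
    by apply: bounded_prec_mono hb; rewrite leq_maxl.
  elim: (nsnd x) v h => [|m IH] v /=; first exact: IHp.
  move=> [u /IH[b hb] /IHq[b' hb']]; exists (maxn b b'); apply/has_iotaP.
  (* The intermediate value [u] is a component of the input of the last step, which lies below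
     [b']. *)
  have /andP[uw _] := bounded_eval_lt hb'; exists u.
    have /andP[_ h1] := npair_ge (nfst x) (npair m u).
    have /andP[_ h2] := npair_ge m u.
    by apply: leq_trans (leq_maxr _ _); lia.
  by rewrite (bounded_prec_mono _ hb) ?(bounded_eval_mono _ hb') ?leq_max ?leqnn ?orbT.
- move=> [/IHp[b0 hb0] h].
  have [b hb] : exists b, forall m, m < v ->
      has (fun u => bounded_eval o n b p (npair x m) u.+1) (iota 0 b).
    apply: collect_bound => [m b b' bb /has_iotaP[u ub hu]|m /h[u /IHp[b hb]]].
      apply/has_iotaP; exists u; first exact: leq_trans bb.
      exact: bounded_eval_mono hu.
    exists b; apply/has_iotaP; exists u => //.
    by have /andP[_ /ltnW] := bounded_eval_lt hb.
  exists (maxn b b0); have /andP[xb _] := bounded_eval_lt hb0.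
  have /andP[xv vv] := npair_ge x v.
  rewrite !leq_max (leq_ltn_trans xv xb) (leq_ltn_trans vv xb) !orbT /=.
  rewrite (bounded_eval_mono _ hb0) ?leq_maxr //=; apply/all_iotaP => m /hb.
  case/has_iotaP => u ub hu; apply/has_iotaP; exists u; first by rewrite leq_max ub.
  by apply: bounded_eval_mono hu; rewrite leq_maxl.
Qed.

Lemma bounded_eval_eq o o' n b p x v :
  (forall z, z < b -> nfst z = n -> o z = o' z) ->
  bounded_eval o n b p x v = bounded_eval o' n b p x v.
Proof.
move=> oo.
elim: p x v => [||||| p IHp q IHq | p IHp q IHq | p IHp q IHq | p IHp] x v //=;
  congr [&& _, _ & _].
- by case: ltnP => //= zb; rewrite oo ?nfst_npair.
- by rewrite IHp IHq.
- by apply: eq_has => u; rewrite IHp IHq.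
- elim: (nsnd x) v => [|m IH] v //=.
  by apply: eq_has => u; rewrite IH IHq.
- by rewrite IHp; congr andb; apply: eq_all => m; apply: eq_has => u; rewrite IHp.
Qed.

(** * Finite approximations of the omega-jump *)

(* The oracle [o] and the jump are split into columns: [u] stands for the
   question whether [nsnd u] is in the [nfst u]-th jump. *)
Definition jump_stage (o : pred nat) (y u : nat) : bool :=
  (0 < nfst u) && `[< exists p v, goedel_number p = nsnd u /\
    bounded_eval o (nfst u).-1 y p (nsnd u) v >].

Definition large_gap (h : nat) (o : pred nat) (x y : nat) : bool :=
  all (fun u => (nfst u <= h) && o u ==> jump_stage o y u) (iota 0 x).

(** The head of the list bounds the outermost jump. Column [0] is always empty, and each further
    bound can make one more column correct. *)
Fixpoint approx (ys : seq nat) : pred nat :=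
  if ys is y :: ys' then fun u => (u < y) && jump_stage (approx ys') y u
  else pred0.

(** The computations behind column [nfst u] consult only the preceding column, at codes below
    [y]. *)
Lemma jump_stage_eq (o o' : pred nat) y u :
  (forall z, z < y -> nfst z < nfst u -> o z = o' z) ->
  jump_stage o y u = jump_stage o' y u.
Proof.
move=> oo; rewrite /jump_stage; case: posnP => //= u0.
have e p v : bounded_eval o (nfst u).-1 y p (nsnd u) v =
    bounded_eval o' (nfst u).-1 y p (nsnd u) v.
  apply: bounded_eval_eq => z zy zu; apply: oo => //. lia.
by apply/asboolP/asboolP => -[p [v [pu h]]]; exists p, v; rewrite e in h *.
Qed.

Lemma jump_stage_mono o y y' u : y <= y' -> jump_stage o y u -> jump_stage o y' u.
Proof.
move=> yy /andP[u0 /asboolP[p [v [pu h]]]]; rewrite /jump_stage u0; apply/asboolP.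
by exists p, v; split=> //; exact: bounded_eval_mono h.
Qed.

Lemma large_gap_eq h (o o' : pred nat) x y : x <= y ->
  (forall z, z < y -> nfst z <= h -> o z = o' z) ->
  large_gap h o x y = large_gap h o' x y.
Proof.
move=> xy oo; apply: eq_in_all => u; rewrite mem_iota => /= ux.
case: (leqP (nfst u) h) => //= uh; rewrite oo ?(leq_trans ux) //.
rewrite (@jump_stage_eq o o') // => z zy zu; apply: oo => //; lia.
Qed.

Lemma large_gap_mono h h' o x x' y y' : h' <= h -> x' <= x -> y <= y' ->
  large_gap h o x y -> large_gap h' o x' y'.
Proof.
move=> hh xx yy /all_iotaP g; apply/all_iotaP => u ux; apply/implyP => /andP[uh ou].
have := g u (leq_trans ux xx); rewrite ou (leq_trans uh hh) /=.
exact: jump_stage_mono.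
Qed.

Notation omega_mem := (fun u => u \in omega_jump).

Lemma omega_mem_npair n : [set z | npair n z \in omega_jump] = iter_jump n.
Proof.
apply/seteqP; split=> z /=.
  move/set_mem => [n' [x [e]]].
  have [<- <-] : n = n' /\ z = x.
    by rewrite -(nfst_npair n z) -{2}(nsnd_npair n z) e nfst_npair nsnd_npair.
  by [].
by move=> h; apply: mem_set; exists n, z.
Qed.

Lemma jump_stage_sound y u : jump_stage omega_mem y u -> u \in omega_jump.
Proof.
case/andP => u0 /asboolP[p [v [pu /bounded_eval_sound]]].
rewrite omega_mem_npair => pv; apply: mem_set; exists (nfst u), (nsnd u).
rewrite npairK; split=> //; rewrite -(prednK u0) /iter_jump iterS.
by exists p, v; split.
Qed.

Lemma jump_stage_complete u : u \in omega_jump -> exists y, jump_stage omega_mem y u.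
Proof.
move/set_mem => [[|n] [x [-> ]]]; first by [].
rewrite /iter_jump iterS => -[p [v [px]]].
rewrite -/(iter_jump n) -omega_mem_npair => /bounded_eval_complete[b hb].
exists b; rewrite /jump_stage nfst_npair nsnd_npair /=; apply/asboolP.
by exists p, v.
Qed.

(** Each of the finitely many members below [x] is confirmed at some stage, and a common stage
    exists by monotonicity. *)
Lemma large_gap_exists h x : exists y, x < y /\ large_gap h omega_mem x y.
Proof.
have [m b b' bb|u ux|y hy] := @collect_bound
  (fun u y => (nfst u <= h) && (u \in omega_jump) ==> jump_stage omega_mem y u) x.
- by move=> /implyP g; apply/implyP => /g; exact: jump_stage_mono.
- case: (boolP (u \in omega_jump)) => [/jump_stage_complete[y hy]|_].
    by exists y; rewrite hy implybT.
  by exists 0; rewrite andbF.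
- exists (maxn x.+1 y); split; first by rewrite leq_max leqnn.
  by apply: (@large_gap_mono h h _ x x y) => //; [rewrite leq_maxr | apply/all_iotaP].
Qed.

(** Induction along the list: the tail is correct below [y] on the lower columns. With a correct
    oracle [jump_stage] is sound, and the large gap from [x] to [y] makes it complete below [x]. *)
Lemma approx_correct h x ys u :
  path (fun x y => (x < y) && large_gap h omega_mem x y) x ys ->
  u < x -> nfst u <= h -> nfst u <= size ys -> approx ys u = (u \in omega_jump).
Proof.
elim: ys x u => [|y ys IH] x u /=.
  move=> _ _ _; rewrite leqn0 => /eqP u0; apply/esym/negbTE/negP => /set_mem.
  by move=> [n [z [e]]]; rewrite e nfst_npair in u0; rewrite u0.
move=> /andP[/andP[xy /all_iotaP g] pys] ux uh us; rewrite (ltn_trans ux xy) /=.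
(* Only columns below [nfst u] are consulted, so the loss of one list entry is harmless. *)
rewrite (@jump_stage_eq _ omega_mem) => [|z zy zu]; last first.
  by apply: (IH y) => //; lia.
apply/idP/idP => [/jump_stage_sound // | uo].
by have := g u ux; rewrite uh uo.
Qed.

(** * The coloring, and the large gaps forced by an avoided color *)

(** All counted gaps end at or before entry [h], and the approximation uses only later entries. If
    [a] has [m + 1] entries with [m] its head, there are [m - h >= h] of these, enough for the
    columns up to [h]. *)
Definition gap_color (a : seq nat) : nat :=
  let h := (head 0 a)./2 in
  \sum_(0 <= i < h)
    large_gap h (approx (drop h.+1 a)) (nth 0 a i) (nth 0 a i.+1).

Definition color (s : large_set) : nat := gap_color (sort leq (val s)).

Lemma infinite_set_unbounded (H : set nat) x : infinite_set H ->
  exists y, (x < y) && (y \in H).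
Proof.
move=> infH; apply: contrapT => h; apply: infH.
apply: (sub_finite_set _ (finite_II x.+1)) => y Hy /=; rewrite ltnS leqNgt.
by apply/negP => xy; apply: h; exists y; rewrite xy mem_set.
Qed.

(** The value [0] is a default for the case that [H] has no element above [x]. *)
Definition next (H : set nat) (x : nat) : nat :=
  if pselect (exists y, (x < y) && (y \in H)) is left e then ex_minn e else 0.

Section Next.
Variables (H : set nat) (infH : infinite_set H).

Lemma nextP x : [/\ x < next H x, next H x \in H &
  forall y, x < y -> y \in H -> next H x <= y].
Proof.
rewrite /next; case: pselect => [e|[]]; last exact: infinite_set_unbounded.
by case: ex_minnP => y /andP[xy Hy] miny; split=> // z xz Hz; rewrite miny ?xz.
Qed.

Lemma iter_next_mem m k : m \in H -> iter k (next H) m \in H.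
Proof. by move=> mH; case: k => //= k; case: (nextP (iter k (next H) m)). Qed.

Lemma iter_next_mono m j k : j <= k -> iter j (next H) m <= iter k (next H) m.
Proof.
move/subnK <-; elim: (k - j) => //= i IH.
by apply: (leq_trans IH); case: (nextP (iter (i + j) (next H) m)) => /ltnW.
Qed.

End Next.

Lemma sorted_large_set (a : seq nat) : sorted ltn a -> size a = (head 0 a).+1 ->
  exists s : large_set, sort leq (val s) = a.
Proof.
move=> sa za; pose s : {fset nat} := [fset x in a]%fset.
have ss : sort leq s = a.
  apply: (sorted_eq leq_trans anti_leq) => //; first exact/sort_sorted/leq_total.
    by apply: sub_sorted sa => x y /ltnW.
  rewrite perm_sort; apply: uniq_perm.
  - exact: fset_uniq.
  - exact: (sorted_uniq ltn_trans ltnn).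
  - by move=> x; rewrite inE.
have ls : exactly_large s.
  by rewrite /exactly_large /fset_min ss -(size_sort leq) ss za.
by exists (exist _ s ls).
Qed.

Lemma avoided_large_gap H c m : infinite_set H -> avoided color H c ->
  m \in H -> c < m./2 ->
  large_gap m./2 omega_mem m (iter (m./2 - c) (next H) m).
Proof.
move=> infH avH mH ch; set h := m./2; set k := h - c.
apply/negPn/negP => ngap; apply: avH.
have /choice[g gP] : forall x, exists y,
    [/\ x < y, y \in H & large_gap h omega_mem x y].
  move=> x; have [y [xy gy]] := large_gap_exists h x.
  have [yz zH _] := nextP infH y; exists (next H y); split=> //.
    exact: ltn_trans yz.
  by apply: large_gap_mono gy; rewrite // ltnW.
(* The first [k] gaps join consecutive elements of [H] and will be small; from index [k] on, [g]
   makes every gap large. *)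
pose a i := if i <= k then iter i (next H) m
  else iter (i - k) g (iter k (next H) m).
have aS i : a i.+1 = if i < k then next H (a i) else g (a i).
  rewrite /a; case: (ltngtP i k) => // [ki | ->].
    by rewrite subSn // ltnW.
  by rewrite subSn // subnn.
have a_lt i : a i < a i.+1.
  by rewrite aS; case: ifP => _; [case: (nextP infH (a i)) | case: (gP (a i))].
have a_mem i : a i \in H.
  by case: i => // i; rewrite aS; case: ifP => _;
    [case: (nextP infH (a i)) | case: (gP (a i))].
have a_mono i j : i <= j -> a i <= a j.
  by move/subnK <-; elim: (j - i) => //= n /leq_trans -> //; exact: ltnW.
have a_gap i : large_gap h omega_mem (a i) (a i.+1) = (k <= i).
  rewrite leqNgt aS; case: ltnP => ik; last by case: (gP (a i)).
  (* A large gap among the first [k] would, by monotonicity, make the enclosing gap from [m] to its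
     [k]-th successor large. *)
  apply/negbTE; apply: contra ngap; rewrite /a (ltnW ik) -iterS.
  apply: large_gap_mono => //; last exact: iter_next_mono.
  by rewrite -[X in X <= _]/(iter 0 (next H) m) iter_next_mono.
(* Two uses: the whole sequence is increasing, and from index [k] on it has large gaps. *)
have pth f n : f = (fun x y => (x < y)) \/
    f = (fun x y => (x < y) && large_gap h omega_mem x y) /\ k <= n ->
    forall l, path f (a n) [seq a i | i <- iota n.+1 l].
  move=> hf l; elim: l n hf => //= l IH n hf; rewrite IH ?andbT; last first.
    by case: hf => [->|[-> kn]]; [left | right; split=> //; exact: leqW].
  by case: hf => [->|[-> kn]]; rewrite a_lt ?a_gap.
have [s ss] : exists s : large_set, sort leq (val s) = [seq a i | i <- iota 0 m.+1].
  apply: sorted_large_set; last by rewrite size_map size_iota.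
  by apply: pth; left.
exists s.
  move=> x /= xs; apply: set_mem.
  have : x \in sort leq (val s) by rewrite mem_sort.
  by rewrite ss => /mapP[i _ ->].
rewrite /color ss /gap_color [head _ _]/= -/h.
(* Hence the [m - h] entries after [a h] suffice for the columns up to [h]. *)
have hm : h + h <= m by rewrite /h; lia.
have -> : drop h.+1 [seq a i | i <- iota 0 m.+1] = [seq a i | i <- iota h.+1 (m - h)].
  by rewrite -map_drop drop_iota.
have apT u : u < a h -> nfst u <= h ->
    approx [seq a i | i <- iota h.+1 (m - h)] u = (u \in omega_jump).
  move=> uh fu; apply: (@approx_correct h (a h)) => //.
    by apply: pth; right; rewrite leq_subr.
  rewrite size_map size_iota; lia.
have a_nth i : i <= m -> nth 0 [seq a i | i <- iota 0 m.+1] i = a i.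
  by move=> im; rewrite (nth_map 0) ?size_iota // nth_iota.
(* The large gaps are those with [k <= i < h], and [h - k = c]. *)
rewrite (eq_big_nat _ _ (F2 := fun i => (k <= i) : nat)) => [|i /andP[_ ih]].
  rewrite (big_cat_nat (n := k)) //= ?leq_subr //.
  rewrite big_nat big1 => [|i]; last by case: leqP.
  rewrite add0n (eq_big_nat _ _ (F2 := fun=> 1)) => [|i /andP[-> _] //].
  rewrite sum_nat_const_nat muln1 /k; lia.
(* The gap at [i < h] consults the oracle only below [a i.+1 <= a h], where the approximation is
   correct. *)
rewrite !a_nth; [|lia..]; rewrite -a_gap; congr nat_of_bool.
apply: large_gap_eq; first exact/ltnW.
by move=> z zi zh; apply: apT => //; apply: (leq_trans zi); exact: a_mono.
Qed.

(** * Bounded evaluation decided by an arithmetical table *)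

(* Course-of-values recursion: bit [entry b e x v] of the table decides
   [bounded_eval] for the program of code [e]; the entries consulted have a
   smaller code or argument, hence a smaller index. *)
Definition entry (b e x v : nat) : nat := (e * b + x) * b + v.

(** The range checks are essential: an argument or value not below [b] could land on the index of
    another entry. *)
Definition lookup (b t e x v : nat) : bool :=
  (x < b) && (v < b) && bit t (entry b e x v).

(** For each [e] exactly one guard holds: codes up to [4] are the basic programs, and above that [r]
    and [k] recover the constructor and its components. [Prec] is split by whether its counter is
    zero. *)
Definition table_step (o n b t e x v : nat) : bool :=
  let r := (e - 5) %% 4 in let k := (e - 5) %/ 4 in
  [&& (e == 0) ==> (v == 0),
      (e == 1) ==> (v == x.+1),
      (e == 2) ==> (v == nfst x),
      (e == 3) ==> (v == nsnd x),
      (e == 4) ==> (npair n x < b) && (v == bit o (npair n x)),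
      (4 < e) && (r == 0) ==>
        lookup b t (nfst k) x (nfst v) && lookup b t (nsnd k) x (nsnd v),
      (4 < e) && (r == 1) ==>
        has (fun u => lookup b t (nsnd k) x u && lookup b t (nfst k) u v) (iota 0 b),
      (4 < e) && (r == 2) && (nsnd x == 0) ==> lookup b t (nfst k) (nfst x) v,
      (4 < e) && (r == 2) && (0 < nsnd x) ==>
        has (fun u => lookup b t e (npair (nfst x) (nsnd x).-1) u &&
          lookup b t (nsnd k) (npair (nfst x) (npair (nsnd x).-1 u)) v) (iota 0 b) &
      (4 < e) && (r == 3) ==> lookup b t k (npair x v) 0 &&
        all (fun m => has (fun u => lookup b t k (npair x m) u.+1) (iota 0 b))
          (iota 0 v)].

Definition table (o n b N : nat) : nat :=
  iteri N (fun i t => t + 2 ^ i *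
    table_step o n b t (i %/ b %/ b) (i %/ b %% b) (i %% b)) 0.

Lemma bit_table o n b N e x v : x < b -> v < b -> entry b e x v < N ->
  bit (table o n b N) (entry b e x v) =
  table_step o n b (table o n b (entry b e x v)) e x v.
Proof.
move=> xb vb; have b0 : 0 < b by lia.
(* Later rounds write only higher digits, so an entry never changes once written. *)
have lt m : table o n b m < 2 ^ m.
  elim: m => //= m IH; rewrite expnS; case: table_step; lia.
elim: N => // N IH; rewrite ltnS leq_eqVlt /= bit_add //.
case: ltngtP => //= [/IH // | <- _]; rewrite {2 3 4}/entry modnMDl (modn_small vb).
rewrite divnMDl // (divn_small vb) addn0.
by rewrite modnMDl (modn_small xb) divnMDl // (divn_small xb) addn0.
Qed.

Lemma entry_lt b e e' x x' v v' : x' < b -> v' < b ->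
  (e' < e) || (e' == e) && (x' < x) -> entry b e' x' v' < entry b e x v.
Proof.
move=> xb vb h; rewrite /entry.
have : e' * b + x' < e * b + x by case/orP: h => [?|/andP[/eqP -> ?]]; nia.
nia.
Qed.

(** Settles all guards of [table_step] at the code of a compound program. *)
Lemma node_code e k r : e = 4 * k + 5 + r -> r < 4 ->
  [/\ [/\ (e == 0) = false, (e == 1) = false, (e == 2) = false,
    (e == 3) = false & (e == 4) = false], 4 < e, (e - 5) %% 4 = r,
    (e - 5) %/ 4 = k & k < e].
Proof. by move=> -> r4; split; [split | ..]; lia. Qed.

Lemma tableP o n b p x v N : x < b -> v < b ->
  entry b (goedel_number p) x v < N ->
  bit (table o n b N) (entry b (goedel_number p) x v) =
  bounded_eval (bit o) n b p x v.
Proof.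
(* Out of range both sides are false; in range the entry must precede the table length [M]. *)
have look p' x' v' M :
    (forall v N, x' < b -> v < b -> entry b (goedel_number p') x' v < N ->
      bit (table o n b N) (entry b (goedel_number p') x' v) =
      bounded_eval (bit o) n b p' x' v) ->
    (x' < b -> v' < b -> entry b (goedel_number p') x' v' < M) ->
    lookup b (table o n b M) (goedel_number p') x' v' =
    bounded_eval (bit o) n b p' x' v'.
  move=> IH lt; rewrite /lookup.
  case: (boolP (x' < b)) => [xb | xb] /=; last first.
    by apply/esym/negP => /bounded_eval_lt/andP[] /(elimN idP xb).
  case: (boolP (v' < b)) => [vb | vb] /=; last first.
    by apply/esym/negP => /bounded_eval_lt/andP[_] /(elimN idP vb).
  by apply: IH => //; exact: lt.
(* The inner induction on [x] is for [Prec], which calls itself under the same code. *)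
elim: p x v N => [||||| p IHp q IHq | p IHp q IHq | p IHp q IHq | p IHp];
  elim/ltn_ind => x IHx v N xb vb lt;
  rewrite (bit_table _ _ xb vb lt) /table_step; set M := entry b _ x v.
- by rewrite /= xb vb /= andbT.
- by rewrite /= xb vb /= andbT.
- by rewrite /= xb vb /= andbT.
- by rewrite /= xb vb /= andbT.
- by rewrite /= xb vb /= andbT.
- have /andP[pk qk] := npair_ge (goedel_number p) (goedel_number q).
  have [[-> -> -> -> ->] -> -> -> ke] :=
    @node_code (goedel_number (Pair p q)) _ 0 (addnA _ 5 0) erefl.
  rewrite nfst_npair nsnd_npair /= xb vb andbT.
  by rewrite (look p _ _ _ (IHp _)) ?(look q _ _ _ (IHq _)) // => *;
    rewrite ?/M; apply: entry_lt => //;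
    rewrite ?(leq_ltn_trans pk ke) ?(leq_ltn_trans qk ke).
- have /andP[pk qk] := npair_ge (goedel_number p) (goedel_number q).
  have [[-> -> -> -> ->] -> -> -> ke] :=
    @node_code (goedel_number (Comp p q)) _ 1 (addnA _ 5 1) erefl.
  rewrite nfst_npair nsnd_npair /= xb vb andbT.
  by apply: eq_has => u;
    rewrite (look p _ _ _ (IHp _)) ?(look q _ _ _ (IHq _)) // => *; rewrite ?/M; apply: entry_lt => //;
    rewrite ?(leq_ltn_trans pk ke) ?(leq_ltn_trans qk ke).
- have /andP[pk qk] := npair_ge (goedel_number p) (goedel_number q).
  have [[-> -> -> -> ->] -> -> -> ke] :=
    @node_code (goedel_number (Prec p q)) _ 2 (addnA _ 5 2) erefl.
  rewrite nfst_npair nsnd_npair [RHS]/= xb vb.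
  move: ke lt IHx (look (Prec p q)); rewrite {}/M.
  move: (goedel_number (Prec p q)) => e ke lt IHx lookPrec /=.
  case Ex : (nsnd x) => [|m] /=.
    by rewrite (look p _ _ _ (IHp _)) ?andbT // => *; rewrite ?/M; apply: entry_lt => //;
      rewrite ?(leq_ltn_trans pk ke).
  have mx : npair (nfst x) m < x by rewrite -{2}(npairK x) Ex; exact: npair_ltr.
  rewrite andbT; apply: eq_in_has => u; rewrite mem_iota => /= ub.
  rewrite (look q _ _ _ (IHq _)) // => [|*]; last first.
    by rewrite ?/M; apply: entry_lt => //; rewrite (leq_ltn_trans qk ke).
  congr andb; rewrite lookPrec // => [|*|*].
  + by rewrite /= nfst_npair nsnd_npair (ltn_trans mx xb) ub.
  + exact: IHx.
  + by rewrite ?/M; apply: entry_lt => //; rewrite eqxx mx orbT.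
- have [[-> -> -> -> ->] -> -> -> ke] :=
    @node_code (goedel_number (Mini p)) _ 3 (addnA _ 5 3) erefl.
  rewrite /= xb vb /=; congr andb.
    by rewrite (look p _ _ _ (IHp _)) // => *;
    rewrite ?/M; apply: entry_lt => //; rewrite ke.
  apply: eq_all => m; apply: eq_has => u.
  by rewrite (look p _ _ _ (IHp _)) // => *;
    rewrite ?/M; apply: entry_lt => //; rewrite ke.
Qed.

(** * Computability of the approximations *)

Section RecursiveStage.
Variable D : set nat -> Prop.
Implicit Types F G O N B Y : set nat -> nat -> nat.

Lemma rec_iter (S2 : set nat -> nat -> nat -> nat) N B :
  recursive_on D (fun A z => S2 A (nfst z) (nsnd z)) -> recursive_on D N ->
  recursive_on D B ->
  recursive_on D (fun A x => iter (N A x) (S2 A x) (B A x)).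
Proof.
move=> rS rN rB.
have : recursive_on D (fun A x => iteri (N A x) (fun _ r => S2 A x r) (B A x)).
  by rec.
by apply: rec_ext => A x _; elim: (N A x) => //= n ->.
Qed.

Lemma rec_table O N B M : recursive_on D O -> recursive_on D N ->
  recursive_on D B -> recursive_on D M ->
  recursive_on D (fun A x => table (O A x) (N A x) (B A x) (M A x)).
Proof.
move=> *; rewrite /table /table_step /lookup /bit /entry; rec.
Qed.

(** As the jump is diagonal, [nsnd u] is both code and input. The table stops right after the
    entries for this code and input. *)
Definition stage_bit (o y u : nat) : bool :=
  [&& 0 < nfst u, nsnd u < y &
    has (fun v => bit (table o (nfst u).-1 y (entry y (nsnd u) (nsnd u) y))
      (entry y (nsnd u) (nsnd u) v)) (iota 0 y)].

Definition mask (o y : nat) : nat := \sum_(0 <= u < y) 2 ^ u * stage_bit o y u.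

Definition approx_mask (ys : seq nat) : nat := foldr (fun y o => mask o y) 0 ys.

Definition gap_bit (h o x y : nat) : bool :=
  all (fun u => (nfst u <= h) && bit o u ==> stage_bit o y u) (iota 0 x).

Lemma rec_stage_bit O F G : recursive_on D O -> recursive_on D F ->
  recursive_on D G ->
  recursive_on D (fun A x => stage_bit (O A x) (F A x) (G A x) : nat).
Proof.
move=> *; rewrite /stage_bit /entry; rec; apply: rec_bit; [apply: rec_table|]; rec.
Qed.

Lemma rec_gap_bit N O F G : recursive_on D N -> recursive_on D O ->
  recursive_on D F -> recursive_on D G ->
  recursive_on D (fun A x => gap_bit (N A x) (O A x) (F A x) (G A x) : nat).
Proof.
move=> *; rewrite /gap_bit; rec; [apply: rec_bit | apply: rec_stage_bit]; rec.
Qed.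

Lemma rec_mask O F : recursive_on D O -> recursive_on D F ->
  recursive_on D (fun A x => mask (O A x) (F A x)).
Proof. by move=> *; rewrite /mask; rec; apply: rec_stage_bit; rec. Qed.

Lemma rec_approx_mask (Y2 : set nat -> nat -> nat -> nat) S K :
  recursive_on2 D Y2 -> recursive_on D S -> recursive_on D K ->
  recursive_on D (fun A x => approx_mask [seq Y2 A x i | i <- iota (S A x) (K A x)]).
Proof.
move=> rY rS rK.
(* [foldr] starts at the end of the list, so round [j] uses the entry at distance [j] from the
   end. *)
have : recursive_on D (fun A x => iteri (K A x)
    (fun j o => mask o (Y2 A x (S A x + (K A x - j.+1)))) 0).
  by rec; apply: rec_mask; rec.
apply: rec_ext => A x _; move: (S A x) (K A x) => s k.
suff h j : j <= k -> iteri j (fun j o => mask o (Y2 A x (s + (k - j.+1)))) 0 =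
    approx_mask [seq Y2 A x i | i <- iota (s + (k - j)) j].
  by rewrite h // subnn addn0.
elim: j => //= j IH jk; rewrite IH; last exact: ltnW.
by have -> : s + (k - j) = (s + (k - j.+1)).+1 by lia.
Qed.

End RecursiveStage.

(** Spares [stage_bit] a test for being a code: the residue of [e - 5] modulo [4] selects the
    constructor, and the components have smaller codes. *)
Lemma goedel_number_surj e : exists p, goedel_number p = e.
Proof.
elim/ltn_ind: e => e IH; have [e5|e5] := ltnP e 5.
  by case: e e5 {IH} => [|[|[|[|[|]]]]] // _;
    [exists Zero | exists Succ | exists Left | exists Right | exists Oracle].
have : (e - 5) %/ 4 < e by lia.
set k := _ %/ 4; move=> ke.
have [p pk] := IH _ (leq_ltn_trans (nfst_le k) ke).
have [q qk] := IH _ (leq_ltn_trans (nsnd_le k) ke).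
have [p' pk'] := IH _ ke.
have : (e - 5) %% 4 < 4 by rewrite ltn_mod.
have := divn_eq (e - 5) 4; rewrite -/k; case: (_ %% 4) => [|[|[|[|]]]] // ek _.
- by exists (Pair p q); rewrite /= pk qk npairK; lia.
- by exists (Comp p q); rewrite /= pk qk npairK; lia.
- by exists (Prec p q); rewrite /= pk qk npairK; lia.
- by exists (Mini p'); rewrite /= pk'; lia.
Qed.

Lemma stage_bitP o y u : stage_bit o y u = jump_stage (bit o) y u.
Proof.
rewrite /stage_bit /jump_stage; case: (0 < nfst u) => //=.
have [p pu] := goedel_number_surj (nsnd u).
have look v : nsnd u < y -> v < y ->
    bit (table o (nfst u).-1 y (entry y (nsnd u) (nsnd u) y))
      (entry y (nsnd u) (nsnd u) v) =
    bounded_eval (bit o) (nfst u).-1 y p (nsnd u) v.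
  move=> uy vy; rewrite -(@tableP o _ y p _ _ (entry y (nsnd u) (nsnd u) y)) ?pu //.
  by rewrite /entry ltn_add2l.
apply/idP/asboolP.
  by case/andP => uy /has_iotaP[v vy]; rewrite look //; exists p, v.
move=> [p' [v [p'u h]]]; have /andP[uy vy] := bounded_eval_lt h.
rewrite uy; apply/has_iotaP; exists v => //; rewrite look //.
by rewrite -(goedel_number_inj (etrans p'u (esym pu))).
Qed.

Lemma bit_approx_mask ys u : bit (approx_mask ys) u = approx ys u.
Proof.
elim: ys u => [|y ys IH] u; first by rewrite /bit div0n.
rewrite /= bit_sum stage_bitP; congr andb; exact: jump_stage_eq.
Qed.

Lemma gap_bitP h o x y : gap_bit h o x y = large_gap h (bit o) x y.
Proof. by apply: eq_all => u; rewrite stage_bitP. Qed.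

(** * Computability of the coloring from canonical indices *)

(* [rank c x] is the number of elements below [x] of the set with canonical
   index [c], and [element c i] its [i]-th element in increasing order. *)
Definition rank (c x : nat) : nat := \sum_(0 <= z < x) bit c z.

Definition element (c i : nat) : nat :=
  \sum_(0 <= x < c) x * (bit c x && (rank c x == i)).

Lemma rank_nth (s : {fset nat}) i : i < #|` s| ->
  rank (canonical_index s) (nth 0 (sort leq s) i) = i.
Proof.
rewrite -(size_sort leq) => si; set a := sort leq s in si *.
have sa : sorted leq a by apply: sort_sorted; exact: leq_total.
have sa' : sorted ltn a by rewrite ltn_sorted_uniq_leq sort_uniq fset_uniq sa.
set x := nth 0 a i; rewrite /rank.
under eq_bigr do rewrite bit_canonical_index.
have -> : \sum_(0 <= z < x) (z \in s) = count (fun z => z < x) a.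
  rewrite -big_mkcond sum1_count /index_iota subn0 -size_filter -[RHS]size_filter.
  apply: perm_size; apply: uniq_perm; rewrite ?filter_uniq ?iota_uniq ?sort_uniq ?fset_uniq //.
  by move=> z; rewrite !mem_filter mem_iota mem_sort andbC.
(* All entries before position [i] are below [x], and none from [i] on. *)
rewrite -[a](cat_take_drop i) count_cat.
have /eqP -> : count (fun z => z < x) (take i a) == i.
  rewrite -[X in _ == X](size_takel (ltnW si)) -all_count; apply/(all_nthP 0) => j.
  rewrite size_takel ?(ltnW si) // => ji; rewrite nth_take //.
  by apply: (sorted_ltn_nth ltn_trans 0 sa'); rewrite ?inE; lia.
rewrite (@eq_in_count _ _ pred0) ?count_pred0 ?addn0 // => z /(nthP 0)[j].
rewrite size_drop nth_drop => ji <-; rewrite ltnNge.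
have -> // : x <= nth 0 a (i + j).
by apply: (sorted_leq_nth leq_trans leqnn 0 sa); rewrite ?inE ?leq_addr -?ltn_subRL.
Qed.

Lemma element_nth (s : {fset nat}) i : i < #|` s| ->
  element (canonical_index s) i = nth 0 (sort leq s) i.
Proof.
move=> si; set x := nth _ _ _.
have xs : x \in s by rewrite -(mem_sort leq) mem_nth // size_sort.
(* The sum defining [element] reaches [x], because [x < 2 ^ x] and [2 ^ x] is a summand of the
   index. *)
have xc : x < canonical_index s.
  rewrite /canonical_index (big_fsetD1 x) //=.
  by apply: (@leq_trans (2 ^ x)); [exact: ltn_expl | exact: leq_addr].
(* Distinct elements have distinct ranks, so every other term vanishes. *)
rewrite /element (bigD1_seq x) ?iota_uniq ?mem_iota /= ?subn0 //.
rewrite bit_canonical_index xs rank_nth // eqxx muln1 big1_seq ?addn0 //.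
move=> y /andP[yx _]; rewrite bit_canonical_index.
case: (boolP (y \in s)) => [|_]; last by rewrite muln0.
rewrite -(mem_sort leq) => /(nthP 0)[j js ey].
rewrite -ey rank_nth; last by rewrite -(size_sort leq).
by case: eqP => [ji | _]; [rewrite -ey ji eqxx in yx | rewrite muln0].
Qed.

Definition color_index (c : nat) : nat :=
  let h := element c 0 %/ 2 in
  let o := approx_mask [seq element c i | i <- iota h.+1 (element c 0 - h)] in
  \sum_(0 <= i < h) gap_bit h o (element c i) (element c i.+1).

Lemma rec_element D F G : recursive_on D F -> recursive_on D G ->
  recursive_on D (fun A x => element (F A x) (G A x)).
Proof. by move=> rF rG; rewrite /element /rank /bit; rec. Qed.

Ltac rec_user ::=
  lazymatch goal with
  | |- recursive_on _ (fun A x => nat_of_bool (bit _ _)) => apply: rec_bit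
  | |- recursive_on _ (fun A x => element _ _) => apply: rec_element
  | |- recursive_on _ (fun A x => nat_of_bool (gap_bit _ _ _ _)) =>
      apply: rec_gap_bit
  | |- recursive_on _ (fun A x => approx_mask [seq _ | i <- iota _ _]) =>
      apply: rec_approx_mask
  end.

Lemma rec_color_index D : recursive_on D (fun _ => color_index).
Proof. by rewrite /color_index; rec. Qed.

Lemma color_indexE (s : large_set) : color_index (canonical_index (val s)) = color s.
Proof.
case: s => s; rewrite /color /= => ls; have /eqP cs := ls.
have fset_min_nth : nth 0 (sort leq s) 0 = fset_min s by rewrite nth0.
have e i : i <= fset_min s -> element (canonical_index s) i = nth 0 (sort leq s) i.
  by move=> im; apply: element_nth; rewrite cs; lia.
rewrite /color_index /gap_color -nth0 !e // fset_min_nth divn2.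
have -> : [seq element (canonical_index s) i | i <- iota (fset_min s)./2.+1
    (fset_min s - (fset_min s)./2)] = drop (fset_min s)./2.+1 (sort leq s).
  rewrite -[in RHS](mkseq_nth 0 (sort leq s)) size_sort cs /mkseq -map_drop drop_iota.
  have -> : 1 + fset_min s - (fset_min s)./2.+1 = fset_min s - (fset_min s)./2 by lia.
  apply/eq_in_map => i; rewrite mem_iota => im; apply: e; lia.
apply: eq_big_nat => i /andP[_ ih]; rewrite gap_bitP !e; [|lia..].
congr nat_of_bool; apply: eq_all => u; rewrite bit_approx_mask.
by congr (_ ==> _); apply: jump_stage_eq => z _ _; exact: bit_approx_mask.
Qed.

(** * Decoding the omega-jump from an infinite set and an avoided color *)

(** The endpoint of the gap provided by [avoided_large_gap]. *)
Definition gap_step (H : set nat) (c m : nat) : nat :=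
  iter (m %/ 2 - c) (next H) m.

(** Half of the start exceeds [c + u]: so [c] is small enough for [avoided_large_gap], and [u] and
    its column lie in the range of correctness. *)
Definition gap_start (H : set nat) (c u : nat) : nat :=
  next H (2 * (c + u) + 2).

(** The list omits the start, below which the result is to be correct; its length [u] covers column
    [nfst u <= u]. *)
Definition decode_omega_jump (H : set nat) (c u : nat) : nat :=
  bit (approx_mask [seq iter i (gap_step H c) (gap_start H c u) | i <- iota 1 u]) u.

Local Notation infinite := (fun H : set nat => infinite_set H).

Lemma rec_next F : recursive_on infinite F ->
  recursive_on infinite (fun H x => next H (F H x)).
Proof.
apply: (@rec_comp _ next).
apply: (@rec_mini _ (fun H x y => (x < y) && (y \in H))) => [|H x infH|H x y infH].
- by rewrite /recursive_on2; rec.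
- by have [-> ->] := nextP infH x.
- by have [_ _ minH] := nextP infH x; case/andP; exact: minH.
Qed.

Lemma rec_decode_omega_jump : recursive_on2 infinite decode_omega_jump.
Proof.
rewrite /decode_omega_jump /gap_step /gap_start; rec.
apply: rec_iter; rec; last by apply: rec_next; rec.
by apply: rec_iter; rec; apply: rec_next; rec.
Qed.

Lemma decode_omega_jumpE H c u : infinite_set H -> avoided color H c ->
  decode_omega_jump H c u = char_fun omega_jump u.
Proof.
move=> infH avH; rewrite /decode_omega_jump /char_fun bit_approx_mask; congr nat_of_bool.
have [n_gt nH _] := nextP infH (2 * (c + u) + 2).
rewrite -/(gap_start H c u) in n_gt nH *; move: (gap_start H c u) n_gt nH => n n_gt nH.
pose m i := iter i (gap_step H c) n.
have mP i : (n <= m i) && (m i \in H).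
  elim: i => [|i /andP[ni iH]]; first by rewrite leqnn.
  rewrite /m iterS -/(m i) iter_next_mem // andbT (leq_trans ni) //.
  exact: (iter_next_mono infH (m i) (leq0n _)).
have pth i l : path (fun x y => (x < y) && large_gap n./2 omega_mem x y) (m i)
    [seq m j | j <- iota i.+1 l].
  elim: l i => // l IH i; apply/andP; split; last exact: IH.
  have /andP[ni iH] := mP i.
  have ci : c < (m i)./2 by lia.
  rewrite (_ : m i.+1 = gap_step H c (m i)) // /gap_step divn2; apply/andP; split.
    apply: (@leq_trans (iter 1 (next H) (m i))); first by case: (nextP infH (m i)).
    by apply: iter_next_mono => //; lia.
  (* The gap is large for the columns up to [(m i)./2], in particular for those up to [n./2]. *)
  apply: large_gap_mono (avoided_large_gap infH avH iH ci) => //; lia.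
apply: (@approx_correct n./2 n) => //.
- exact: (pth 0).
- by lia.
- by have := nfst_le u; lia.
- by rewrite size_map size_iota nfst_le.
Qed.

Theorem theorem4p6 :
  exists f : large_set -> nat,
    computable_coloring f /\
    (forall H : set nat,
       infinite_set H -> thin f H -> turing_le omega_jump H) /\
    (exists Phi : program,
       forall (H : set nat) (c : nat),
         infinite_set H -> avoided f H c ->
         functional_value Phi H c omega_jump).
Proof.
have [Phi PhiP] := rec_decode_omega_jump.
have PhiE H c : infinite_set H -> avoided color H c ->
    functional_value Phi H c omega_jump.
  move=> infH avH u; rewrite -(decode_omega_jumpE _ infH avH).
  by have := PhiP H infH (npair c u); rewrite nfst_npair nsnd_npair.
exists color; split.
  have [p pP] := rec_color_index (fun _ => True).
  by exists p => s; rewrite -color_indexE; exact: pP.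
split; last by exists Phi.
move=> H infH thinH.
have [c avc] : exists c, avoided color H c.
  apply: contrapT => h; apply: thinH; apply/seteqP; split=> // c _.
  by apply: contrapT => nc; apply: h; exists c.
(* For a mere reduction the avoided color is built into the program as a constant. *)
have [p pP] : recursive_on infinite (fun H u => decode_omega_jump H c u).
  by apply: (rec_comp2 rec_decode_omega_jump); rec.
by exists p => u; rewrite -(decode_omega_jumpE _ infH avc); exact: pP.
Qed.
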